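(* Let $(M,g)$ be a complete steady gradient Ricci soliton with potential function $f$, that is, $Rc+H_f=0$. Assume that $(M,g)$ is not Ricci flat and that it is normalized so that $R+|\nabla f|^2=1$ on $M$. Suppose that $(M,g)$ has nonnegative Ricci curvature. Then for every fixed point $O\in M$ there exists a constant $k$ with $0<k\leq 1$, depending only on $O$ and $R(O)$, such that for all $x\in M$ $$R(x)\geq k\,\operatorname{sech}^2 r(x),$$ where $r(x)$ is the Riemannian distance from $O$ to $x$.
   Context: A gradient Ricci soliton is a (connected) Riemannian manifold $(M,g)$ together with a smooth function $f:M\to\mathbb{R}$ (the potential function) and a constant $\lambda\in\mathbb{R}$ such that $Rc+H_f=\lambda g$, where $Rc$ is the Ricci tensor and $H_f$ is the Hessian of $f$. It is called steady if $\lambda=0$. $R$ denotes the scalar curvature, and $|\cdot|$ denotes the norm induced by $g$. On a steady gradient Ricci soliton it is well known that $R+|\nabla f|^2=C$ for a constant $C$, which is positive unless the soliton is Ricci flat; the metric is scaled so that $C=1$. Here $\operatorname{sech} t=1/\cosh t$. *)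

(* Defs.v *)
From HB Require Import structures.
From mathcomp Require Import all_boot all_order all_algebra.
From mathcomp Require Import all_classical all_reals all_analysis.

Set Implicit Arguments.
Unset Strict Implicit.
Unset Printing Implicit Defensive.

Import Order.TTheory GRing.Theory Num.Theory.
Import numFieldNormedType.Exports.

Local Open Scope classical_set_scope.
Local Open Scope ring_scope.

Definition cosh (R : realType) (t : R) : R := (expR t + expR (- t)) / 2.
Definition sech (R : realType) (t : R) : R := (cosh t)^-1.

Definition partial (R : realType) (n : nat) (V : normedModType R) (i : 'I_n)
  (h : 'rV[R]_n -> V) : 'rV[R]_n -> V := fun y => 'D_(delta_mx 0 i) h y.

(* C^oo on the open set U: all iterated partial derivatives, of every order,
   are Frechet differentiable at every point of U. *)
Definition smooth_on (R : realType) (n : nat) (V : normedModType R)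
    (U : set 'rV[R]_n) (h : 'rV[R]_n -> V) : Prop :=
  forall (s : seq 'I_n) (y : 'rV[R]_n), U y ->
    differentiable (foldr (fun i k => partial i k) h s) y.

(* A smooth n-manifold, given by a smooth atlas which need not be maximal.
   The maps chart c and param c are total functions, but only their
   restrictions to dom c and img c, which are mutually inverse homeomorphisms
   between open sets, are meaningful. *)
Record manifold (R : realType) (n : nat) := Manifold {
  carrier :> topologicalType;
  atlas : Type;
  dom : atlas -> set carrier;
  img : atlas -> set 'rV[R]_n;
  chart : atlas -> carrier -> 'rV[R]_n;
  param : atlas -> 'rV[R]_n -> carrier;
  chart_at : carrier -> atlas;
  manifold_hausdorff : hausdorff_space carrier;
  manifold_second_countable : @second_countable carrier;
  open_dom : forall c, open (dom c);
  open_img : forall c, open (img c);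
  chart_img : forall c x, dom c x -> img c (chart c x);
  param_dom : forall c y, img c y -> dom c (param c y);
  chartK : forall c x, dom c x -> param c (chart c x) = x;
  paramK : forall c y, img c y -> chart c (param c y) = y;
  chart_continuous : forall c x, dom c x -> {for x, continuous (chart c)};
  param_continuous : forall c y, img c y -> {for y, continuous (param c)};
  dom_chart_at : forall x, dom (chart_at x) x;
  transition_smooth : forall a b,
    smooth_on [set y | img a y /\ dom b (param a y)] (chart b \o param a)
}.

Definition smooth_fun (R : realType) (n : nat) (M : manifold R n)
    (f : M -> R) : Prop :=
  forall c : atlas M, smooth_on (img c) (f \o param c).

(* gmat g c y is the matrix (g_ij) of the metric in the chart c at the point
   of coordinates y.  Tangent vectors are row vectors of components, so that a
   change of chart with Jacobian J (in the row convention of jacobian) sends v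
   to v *m J. *)
Record metric (R : realType) (n : nat) (M : manifold R n) := Metric {
  gmat : atlas M -> 'rV[R]_n -> 'M[R]_n;
  gmat_sym : forall c y, img c y -> (gmat c y)^T = gmat c y;
  gmat_pos : forall c y, img c y ->
    forall v : 'rV[R]_n, v != 0 -> 0 < (v *m gmat c y *m v^T) 0 0;
  gmat_smooth : forall c i j, smooth_on (img c) (fun y => gmat c y i j);
  gmat_change : forall a b x, dom a x -> dom b x ->
    let J := 'J (chart b \o param a) (chart a x) in
    gmat a (chart a x) = J *m gmat b (chart b x) *m J^T
}.

Section local_tensors.
Variables (R : realType) (n : nat) (M : manifold R n) (g : metric M).
Variable c : atlas M.
Implicit Types (y v : 'rV[R]_n) (i j k l m : 'I_n) (f : M -> R).

Definition norm2 y v : R := (v *m gmat g c y *m v^T) 0 0.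

(* Gamma^k_ij, for the Levi-Civita connection *)
Definition christoffel k i j y : R :=
  2^-1 * \sum_l invmx (gmat g c y) k l *
    (partial i (fun z => gmat g c z j l) y
     + partial j (fun z => gmat g c z i l) y
     - partial l (fun z => gmat g c z i j) y).

(* The component l of
   Rm(d_i, d_j) d_k = nabla_i nabla_j d_k - nabla_j nabla_i d_k. *)
Definition riemann l i j k y : R :=
  partial i (christoffel l j k) y - partial j (christoffel l i k) y
  + \sum_m (christoffel m j k y * christoffel l i m y
            - christoffel m i k y * christoffel l j m y).

(* Rc(d_j, d_k) is the trace of X |-> Rm(X, d_j) d_k; with this sign round
   spheres have positive Ricci curvature. *)
Definition ricci y : 'M[R]_n := \matrix_(j, k) \sum_i riemann i i j k y.

Definition scal_in y : R := \tr (invmx (gmat g c y) *m ricci y).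

Definition hessian f y : 'M[R]_n :=
  \matrix_(i, j) (partial i (partial j (f \o param c)) y
                  - \sum_k christoffel k i j y * partial k (f \o param c) y).

Definition gradient f y : 'rV[R]_n :=
  (\row_i partial i (f \o param c) y) *m invmx (gmat g c y).

End local_tensors.

(* Scalar curvature as a function on M; the value does not depend on the chart
   around x. *)
Definition scal (R : realType) (n : nat) (M : manifold R n) (g : metric M)
    (x : M) : R :=
  scal_in g (chart_at x) (chart (chart_at x) x).

Section curves.
Variables (R : realType) (n : nat) (M : manifold R n) (g : metric M).
Implicit Types (gamma : R -> M) (x y : M).

Definition C1_at gamma (t : R) : Prop :=
  {for t, continuous gamma} /\
  forall c : atlas M, dom c (gamma t) ->
    (\forall s \near t, derivable (chart c \o gamma) s (1 : R)) /\
    {for t, continuous (derive1 (chart c \o gamma))}.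

Definition speed gamma (t : R) : R :=
  let c := chart_at (gamma t) in
  Num.sqrt (norm2 g c (chart c (gamma t)) (derive1 (chart c \o gamma) t)).

Definition curve_length gamma : R :=
  \int[lebesgue_measure]_(t in `[0, 1]) speed gamma t.

(* A piecewise C^1 curve from x to y is given by the list of its C^1 pieces,
   each of them parametrized by [0, 1] and extended to a C^1 curve on a
   neighbourhood of [0, 1]; values outside this neighbourhood are irrelevant. *)
Fixpoint piecewise_C1 x y (p : seq (R -> M)) : Prop :=
  if p is gamma :: q then
    [/\ forall t : R, 0 <= t <= 1 -> C1_at gamma t, gamma 0 = x
      & piecewise_C1 (gamma 1) y q]
  else x = y.

(* Riemannian distance, on a connected manifold *)
Definition rdist x y : R :=
  inf [set \sum_(gamma <- p) curve_length gamma | p in piecewise_C1 x y].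

Definition complete_metric : Prop :=
  forall u : nat -> M,
    (forall e : R, 0 < e -> exists N : nat, forall i j : nat,
      (N <= i)%N -> (N <= j)%N -> rdist (u i) (u j) < e) ->
    exists x : M, (fun i : nat => rdist (u i) x) @ \oo --> (0 : R).

End curves.

Section solitons.
Variables (R : realType) (n : nat) (M : manifold R n) (g : metric M).
Implicit Types f : M -> R.

Definition gradient_ricci_soliton f (lambda : R) : Prop :=
  smooth_fun f /\
  forall c y, img c y ->
    ricci g c y + hessian g c f y = lambda *: gmat g c y.

Definition steady_soliton f : Prop := gradient_ricci_soliton f 0.

Definition ricci_flat : Prop := forall (c : atlas M) y, img c y -> ricci g c y = 0.

Definition ricci_nonneg : Prop :=
  forall (c : atlas M) y, img c y ->
    forall v : 'rV[R]_n, 0 <= (v *m ricci g c y *m v^T) 0 0.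

(* R + |grad f|^2 = 1 *)
Definition normalized f : Prop :=
  forall (c : atlas M) y, img c y ->
    scal_in g c y + norm2 g c y (gradient g c f y) = 1.

End solitons.

(* Main.v *)
Require Import Defs.
From HB Require Import structures.
From mathcomp Require Import all_boot all_order all_algebra.
From mathcomp Require Import all_classical all_reals all_analysis.
From mathcomp Require Import perm ring lra.

Set Implicit Arguments.
Unset Strict Implicit.
Unset Printing Implicit Defensive.

Import Order.TTheory GRing.Theory Num.Theory.
Import numFieldNormedType.Exports.

Local Open Scope classical_set_scope.
Local Open Scope ring_scope.

(** Write S for the scalar curvature. Since [S = 1 - |grad f|^2] and
    [Hess f = - Rc], and since [d |grad f|^2 = 2 Hess f (grad f, .)]
    ([is_derive_energy]), the identity [dS = 2 Rc (grad f, .)] holds without the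
    contracted Bianchi identity. A nonnegative symmetric form is bounded by its
    trace ([psd_pairing_le]), and [|grad f| <= 1] because [S >= 0], so
    [|dS (w)| <= 2 S |w|] ([scal_in_derive]).

    Along a piecewise C^1 curve of length L from O to x, Gronwall's inequality
    then gives [S(O) <= S(x) e^(2L)] ([scal_piecewise_C1_curve]). Such curves
    exist because M is connected ([piecewise_C1_connected]); the infimum over
    all of them yields [S(x) >= S(O) e^(-2 r(x))] ([scal_exp_decay]). As
    [sech^2 r <= 4 e^(-2r)], the constant [k = S(O) / 4] works. It is positive:
    if S had a zero, the same inequality would make S vanish identically, hence
    Rc, a nonnegative form with zero trace, would vanish too ([scal_gt0]).

    The tensors are given chart by chart, so two facts have to be established
    about them: Rc is symmetric, which for a soliton is Schwarz's theorem
    [partialC] applied to f; and S and the speed of a curve do not depend on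
    the chart, which only takes the change of first derivatives of f
    ([energy_change]) and of velocities ([velocity_change]). *)

(** * Positive quadratic forms *)

Section positive_matrices.
Variable R : realType.

Definition pairing (n : nat) (S : 'M[R]_n) (u v : 'rV[R]_n) : R :=
  (u *m S *m v^T) 0 0.

Lemma pairingE n (S : 'M[R]_n) u v :
  pairing S u v = \sum_i \sum_j u 0 i * S i j * v 0 j.
Proof.
rewrite /pairing mxE exchange_big /=; apply: eq_bigr => j _.
by rewrite !mxE big_distrl.
Qed.

Lemma mulmx_rowC n (u v : 'rV[R]_n) : (u *m v^T) 0 0 = (v *m u^T) 0 0.
Proof. by rewrite !mxE; apply: eq_bigr => i _; rewrite !mxE mulrC. Qed.

Lemma pairingC n (S : 'M[R]_n) u v : S^T = S -> pairing S u v = pairing S v u.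
Proof.
by move=> symS; rewrite /pairing mulmx_rowC trmx_mul symS mulmxA.
Qed.

Lemma pairingDl n (S : 'M[R]_n) u v w :
  pairing S (u + v) w = pairing S u w + pairing S v w.
Proof. by rewrite /pairing !mulmxDl mxE. Qed.

Lemma pairingZl n (S : 'M[R]_n) a u w :
  pairing S (a *: u) w = a * pairing S u w.
Proof. by rewrite /pairing -!scalemxAl mxE. Qed.

Lemma pairingDr n (S : 'M[R]_n) u v w :
  pairing S w (u + v) = pairing S w u + pairing S w v.
Proof. by rewrite /pairing linearD mulmxDr mxE. Qed.

Lemma pairingZr n (S : 'M[R]_n) a u w :
  pairing S w (a *: u) = a * pairing S w u.
Proof. by rewrite /pairing linearZ -scalemxAr mxE. Qed.

Lemma pairing_delta n (S : 'M[R]_n) i j :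
  pairing S (delta_mx 0 i) (delta_mx 0 j) = S i j.
Proof. by rewrite /pairing -rowE trmx_delta -colE !mxE. Qed.

Lemma pairing_congr n (B S : 'M[R]_n) u v :
  pairing (B *m S *m B^T) u v = pairing S (u *m B) (v *m B).
Proof. by rewrite /pairing trmx_mul !mulmxA. Qed.

Lemma invmx_mul n (A B : 'M[R]_n) : A \in unitmx -> B \in unitmx ->
  invmx (A *m B) = invmx B *m invmx A.
Proof.
move=> uA uB; have uAB : A *m B \in unitmx by rewrite unitmx_mul uA.
apply: (can_inj (mulKmx uAB)); rewrite mulmxV//.
by rewrite mulmxA mulmxK// mulmxV.
Qed.

Definition psd n (S : 'M[R]_n) := forall v, 0 <= pairing S v v.
Definition posdef n (S : 'M[R]_n) := forall v, v != 0 -> 0 < pairing S v v.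

(** The quadratic polynomial [x, y |-> S(xu + yv, xu + yv)] is nonnegative.
    It is evaluated where it is minimal in x for fixed y; when [S(u, u) = 0] it
    is affine in x for [y = 1], so that [S(u, v)] has to vanish. *)
Lemma psd_cauchy_schwarz n (S : 'M[R]_n) u v : S^T = S -> psd S ->
  pairing S u v ^+ 2 <= pairing S u u * pairing S v v.
Proof.
move=> symS psdS.
set a := pairing S u u; set b := pairing S u v; set c := pairing S v v.
have quad x y : 0 <= x ^+ 2 * a + 2 * x * y * b + y ^+ 2 * c.
  have := psdS (x *: u + y *: v).
  rewrite !(pairingDl, pairingDr, pairingZl, pairingZr) (pairingC v u symS).
  by rewrite -/a -/b -/c; congr (_ <= _); ring.
have a0 : 0 <= a by exact: psdS.
have [a00|an0] := eqVneq a 0.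
  have [->|bn0] := eqVneq b 0; first by rewrite expr0n mulr_ge0 ?psdS.
  have := quad (- (c + 1) / (2 * b)) 1; rewrite a00.
  have -> : 2 * (- (c + 1) / (2 * b)) * 1 * b = - (c + 1) by field.
  have -> : (- (c + 1) / (2 * b)) ^+ 2 * 0 - (c + 1) + 1 ^+ 2 * c = -1 by ring.
  by rewrite oppr_ge0 lt_geF.
have ap : 0 < a by rewrite lt_def an0.
have := quad (- b) a.
have -> : (- b) ^+ 2 * a + 2 * - b * a * b + a ^+ 2 * c = a * (a * c - b ^+ 2).
  by ring.
by rewrite pmulr_rge0// subr_ge0.
Qed.

Lemma pairing1 n (u v : 'rV[R]_n) : pairing 1%:M u v = \sum_i u 0 i * v 0 i.
Proof. by rewrite /pairing mulmx1 mxE; apply: eq_bigr => i _; rewrite mxE. Qed.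

Lemma pairing1_ge0 n (u : 'rV[R]_n) : 0 <= pairing 1%:M u u.
Proof. by rewrite pairing1 sumr_ge0// => i _; rewrite -expr2 sqr_ge0. Qed.

Lemma cauchy_schwarz_sum n (u v : 'I_n -> R) :
  (\sum_i u i * v i) ^+ 2 <= (\sum_i u i ^+ 2) * \sum_i v i ^+ 2.
Proof.
have /(psd_cauchy_schwarz (\row_i u i) (\row_i v i)) :
    (1%:M : 'M[R]_n)^T = 1%:M by rewrite trmx1.
move=> /(_ (@pairing1_ge0 n)); rewrite !pairing1.
under eq_bigr do rewrite !mxE.
by under [X in _ <= X * _]eq_bigr do rewrite !mxE -expr2;
  under [X in _ <= _ * X]eq_bigr do rewrite !mxE -expr2.
Qed.

Lemma psd_diag_ge0 n (S : 'M[R]_n) i : psd S -> 0 <= S i i.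
Proof. by move=> psdS; rewrite -pairing_delta. Qed.

Lemma psd_trace_ge0 n (S : 'M[R]_n) : psd S -> 0 <= \tr S.
Proof. by move=> psdS; rewrite sumr_ge0// => i _; exact: psd_diag_ge0. Qed.

Lemma psd_entry_le n (S : 'M[R]_n) i j : S^T = S -> psd S ->
  `|S i j| <= Num.sqrt (S i i) * Num.sqrt (S j j).
Proof.
move=> symS psdS; rewrite -sqrtrM ?psd_diag_ge0// -sqrtr_sqr ler_wsqrtr//.
by rewrite -!pairing_delta psd_cauchy_schwarz.
Qed.

(** The case [G = 1] of [psd_pairing_le]. By Cauchy-Schwarz for S,
    [|S_ij| <= s_i s_j] with [s_i = sqrt S_ii]; hence
    [|S(u, v)| <= (sum |u_i| s_i) (sum |v_j| s_j)], and Cauchy-Schwarz in each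
    factor produces the norms and [sum s_i^2 = tr S]. *)
Lemma psd_pairing_le1 n (S : 'M[R]_n) u v : S^T = S -> psd S ->
  `|pairing S u v| <=
    Num.sqrt (pairing 1%:M u u) * Num.sqrt (pairing 1%:M v v) * \tr S.
Proof.
move=> symS psdS; pose s i := Num.sqrt (S i i).
have half (w : 'rV[R]_n) :
    \sum_i `|w 0 i| * s i <= Num.sqrt (pairing 1%:M w w) * Num.sqrt (\tr S).
  rewrite -sqrtrM ?pairing1_ge0// -[leLHS]ger0_norm ?sumr_ge0//; last first.
    by move=> i _; rewrite mulr_ge0 ?sqrtr_ge0.
  rewrite -sqrtr_sqr ler_wsqrtr// (le_trans (cauchy_schwarz_sum _ _))// pairing1.
  rewrite le_eqVlt; apply/orP; left; apply/eqP; congr (_ * _).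
    by apply: eq_bigr => i _; rewrite real_normK ?num_real// expr2.
  by apply: eq_bigr => i _; rewrite sqr_sqrtr// psd_diag_ge0.
have -> : Num.sqrt (pairing 1%:M u u) * Num.sqrt (pairing 1%:M v v) * \tr S =
  (Num.sqrt (pairing 1%:M u u) * Num.sqrt (\tr S)) *
  (Num.sqrt (pairing 1%:M v v) * Num.sqrt (\tr S)).
  by rewrite mulrACA -expr2 sqr_sqrtr// psd_trace_ge0.
apply: le_trans (ler_pM _ _ (half u) (half v)); last 2 first.
- by rewrite sumr_ge0// => i _; rewrite mulr_ge0 ?sqrtr_ge0.
- by rewrite sumr_ge0// => i _; rewrite mulr_ge0 ?sqrtr_ge0.
rewrite pairingE (le_trans (ler_norm_sum _ _ _))// mulr_suml ler_sum// => i _.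
rewrite (le_trans (ler_norm_sum _ _ _))// mulr_sumr ler_sum// => j _.
rewrite !normrM [leRHS]mulrACA [leLHS]mulrAC ler_wpM2l ?mulr_ge0//.
exact: psd_entry_le.
Qed.

Lemma posdef_unitmx n (G : 'M[R]_n) : posdef G -> G \in unitmx.
Proof.
move=> pG; rewrite -row_free_unit -kermx_eq0; apply/rowV0P => v /sub_kermxP vG.
apply/eqP/negPn/negP => /pG; by rewrite /pairing vG mul0mx mxE ltxx.
Qed.

(** Induction on the size: clearing the first row and column of G is a
    congruence by a unipotent matrix L, and the Schur complement that remains
    is again positive definite. *)
Lemma posdef_cholesky n (G : 'M[R]_n) : G^T = G -> posdef G ->
  exists2 B : 'M[R]_n, B \in unitmx & G = B *m B^T.
Proof.
move=> symG pG.
suff [B GB] : exists B : 'M[R]_n, G = B *m B^T.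
  exists B => //; have := posdef_unitmx pG.
  by rewrite GB unitmx_mul => /andP[].
elim: n G symG pG => [|n IH] G symG pG.
  by exists 0; apply/matrixP => -[].
move: G symG pG; rewrite -[n.+1]/(1 + n)%N => G symG pG.
set a := G 0 0.
have ulE : ulsubmx G = a%:M.
  apply/matrixP => i j; rewrite !ord1 !mxE eqxx mulr1n.
  by congr (G _ _); apply/val_inj.
set b := ursubmx G; set D := drsubmx G.
have dlE : dlsubmx G = b^T.
  by rewrite /b -[in RHS]symG -trmx_dlsub trmxK.
have symD : D^T = D by rewrite /D trmx_drsub symG.
have GE : G = block_mx a%:M b b^T D by rewrite -dlE -ulE submxK.
have a0 : 0 < a.
  rewrite /a -pairing_delta; apply: pG.
  by apply/eqP => /matrixP/(_ 0 0)/eqP; rewrite !mxE !eqxx oner_eq0.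
(* the Schur complement of the entry a *)
pose D' := D - a^-1 *: (b^T *m b).
pose L : 'M[R]_(1 + n) := block_mx 1%:M 0 (a^-1 *: b^T) 1%:M.
have GL : G = L *m block_mx a%:M 0 0 D' *m L^T.
  rewrite GE tr_block_mx !mulmx_block !trmx1 !trmx0 !linearZ /= trmxK.
  rewrite !mul1mx !mulmx1 !mulmx0 !mul0mx !addr0 !add0r.
  rewrite mul_scalar_mx mul_mx_scalar !scalerA divff ?gt_eqF// !scale1r.
  by rewrite /D' mulVf ?gt_eqF// scale1r addrC subrK.
have symD' : D'^T = D'.
  by rewrite /D' linearB linearZ /= trmx_mul trmxK symD.
have pD' : posdef D'.
  move=> v v0; pose x : 'rV[R]_(1 + n) := row_mx (- (a^-1 *: (v *m b^T))) v.
  (* x is the vector that L sends to v padded by 0 *)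
  have xL : x *m L = row_mx 0 v.
    rewrite /x /L mul_row_block !mulmx1 mulmx0 add0r -scalemxAr.
    by rewrite addNr.
  have x0 : x != 0.
    apply: contraNneq v0 => x0; rewrite -[v](row_mxKr (- (a^-1 *: (v *m b^T)))).
    by rewrite -/x x0 linear0.
  have := pG x x0; rewrite GL pairing_congr xL /pairing mul_row_block.
  by rewrite !mul0mx !mulmx0 !add0r tr_row_mx mul_row_col mul0mx add0r.
have [B' D'B] := IH _ symD' pD'.
exists (L *m block_mx (Num.sqrt a)%:M 0 0 B').
rewrite {1}GL trmx_mul !mulmxA; congr (_ *m _); rewrite -!mulmxA; congr (_ *m _).
rewrite tr_block_mx mulmx_block tr_scalar_mx !trmx0 !mulmx0 !mul0mx.
by rewrite !addr0 !add0r -scalar_mxM -expr2 sqr_sqrtr ?ltW// -D'B.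
Qed.

(** In coordinates where G is the standard inner product, given by a Cholesky
    factor of G, this is [psd_pairing_le1]. It bounds a nonnegative form by its
    trace without diagonalizing it. *)
Lemma psd_pairing_le n (G S : 'M[R]_n) u v :
  G^T = G -> posdef G -> S^T = S -> psd S ->
  `|pairing S u v| <=
    Num.sqrt (pairing G u u) * Num.sqrt (pairing G v v) * \tr (invmx G *m S).
Proof.
move=> symG pG symS psdS; have [B uB GB] := posdef_cholesky symG pG.
pose S' := invmx B *m S *m (invmx B)^T.
have uBT : B^T \in unitmx by rewrite unitmx_tr.
have SB : S = B *m S' *m B^T.
  rewrite /S' trmx_inv -!mulmxA mulVmx// mulmx1 !mulmxA mulmxV//.
  by rewrite mul1mx.
have -> : \tr (invmx G *m S) = \tr S'.
  rewrite GB invmx_mul// SB -!mulmxA mxtrace_mulC -!mulmxA mulmxV// mulmx1.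
  by rewrite mulKmx// /S' mulmxA.
have GB1 : G = B *m 1%:M *m B^T by rewrite mulmx1.
have symS' : S'^T = S' by rewrite /S' !trmx_mul trmxK symS mulmxA.
have psdS' : psd S' by move=> w; rewrite /S' pairing_congr; exact: psdS.
clearbody S'; rewrite SB GB1 !pairing_congr; exact: psd_pairing_le1.
Qed.

Lemma psd_trace_inv_ge0 n (G S : 'M[R]_n) :
  G^T = G -> posdef G -> psd S -> 0 <= \tr (invmx G *m S).
Proof.
move=> symG pG psdS; have [B uB ->] := posdef_cholesky symG pG.
have uBT : B^T \in unitmx by rewrite unitmx_tr.
rewrite invmx_mul// -mulmxA mxtrace_mulC -trmx_inv.
by apply: psd_trace_ge0 => w; rewrite pairing_congr.
Qed.

End positive_matrices.

(** * Curves in a normed space and symmetry of second derivatives *)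

Section differential_calculus.
Variable R : realType.

Lemma is_derive_comp_curve (V W : normedModType R) (F : V -> W) (y : R -> V)
    (t : R) (y' : V) :
  differentiable F (y t) -> is_derive t (1 : R) y y' ->
  is_derive t (1 : R) (F \o y) ('D_y' F (y t)).
Proof.
move=> dF [dy <-].
have dy' : differentiable y t by apply/derivable1_diffP.
have dFy : differentiable (F \o y) t by exact: differentiable_comp.
apply: DeriveDef; first exact/derivable1_diffP.
by rewrite !deriveE// diff_comp.
Qed.

Lemma derive_partialE n (V : normedModType R) (F : 'rV[R]_n -> V) p w :
  differentiable F p -> 'D_w F p = \sum_i w 0 i *: partial i F p.
Proof.
move=> dF; rewrite deriveE// [in LHS](row_sum_delta w) linear_sum.
by apply: eq_bigr => i _; rewrite linearZ /partial deriveE.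
Qed.

Lemma is_derive_line (V : normedModType R) (p v : V) (t : R) :
  is_derive t (1 : R) (fun s : R => p + s *: v) v.
Proof.
have -> : (fun s : R => p + s *: v) = (cst p + ( *:%R ^~ v)) by [].
have d : is_diff t ( *:%R ^~ v : R -> V) ( *:%R ^~ v) by exact: is_diff_scalel.
have dl : is_derive t (1 : R) ( *:%R ^~ v : R -> V) v.
  by apply: DeriveDef; [exact: diff_derivable|rewrite deriveE// diff_val scale1r].
have dc : is_derive t (1 : R) (cst p : R -> V) 0 by exact: is_derive_cst.
by have := is_deriveD dc dl; rewrite add0r.
Qed.

Lemma is_derive_along (V W : normedModType R) (F : V -> W) (p v : V) (t : R) :
  differentiable F (p + t *: v) ->
  is_derive t (1 : R) (fun s : R => F (p + s *: v)) ('D_v F (p + t *: v)).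
Proof.
move=> dF; exact: (is_derive_comp_curve dF (is_derive_line p v t)).
Qed.

Lemma norm_delta_le1 n (i : 'I_n) : `|delta_mx 0 i : 'rV[R]_n| <= 1.
Proof.
rewrite /Num.Def.normr/= mx_normrE bigmax_le// => -[a b] _ /=.
by rewrite mxE; case: (_ && _); rewrite ?normr1 ?normr0.
Qed.

(** The mean value theorem, first in the direction [ei], then in the direction
    [ej]. The second difference on the left is symmetric in [i] and [j], which is
    what makes [partialC] follow. *)
Lemma second_difference_mvt n (h : 'rV[R]_n -> R) (y : 'rV[R]_n) (r s : R)
    (i j : 'I_n) (ei := delta_mx 0 i : 'rV[R]_n) (ej := delta_mx 0 j : 'rV[R]_n) :
  (forall z, `|z - y| < r -> differentiable h z) ->
  (forall z, `|z - y| < r -> differentiable (partial i h) z) ->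
  0 < s -> s + s < r ->
  exists2 z, `|z - y| <= s + s &
    h (y + s *: ei + s *: ej) - h (y + s *: ei) - h (y + s *: ej) + h y =
    s ^+ 2 * partial j (partial i h) z.
Proof.
move=> dh dih s0 sr.
have near_y (a b : R) : 0 <= a <= s -> 0 <= b <= s ->
    `|(y + a *: ei + b *: ej) - y| <= s + s.
  move=> /andP[a0 as_] /andP[b0 bs].
  rewrite -(addrA y) addrAC subrr add0r (le_trans (ler_normD _ _))// lerD// normrZ ger0_norm//.
    by rewrite -[leRHS]mulr1 ler_pM//; exact: norm_delta_le1.
  by rewrite -[leRHS]mulr1 ler_pM//; exact: norm_delta_le1.
have in_r a b : 0 <= a <= s -> 0 <= b <= s ->
    `|(y + a *: ei + b *: ej) - y| < r.
  by move=> ha hb; rewrite (le_lt_trans _ sr)// near_y.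
have ss : 0 <= s <= s by rewrite ltW/=.
have os : 0 <= (0 : R) <= s by rewrite lexx ltW.
pose g t := h (y + s *: ej + t *: ei) - h (y + t *: ei).
have dg (t : R) : 0 <= t <= s -> is_derive t (1 : R) g
    (partial i h (y + s *: ej + t *: ei) - partial i h (y + t *: ei)).
  move=> ts; apply: is_deriveB; apply: is_derive_along; apply: dh.
    by rewrite (addrAC y (s *: ej)); exact: in_r.
  by have := in_r t 0 ts os; rewrite scale0r addr0.
have mvt0 (k dk : R -> R) :
    (forall t : R, 0 <= t <= s -> is_derive t (1 : R) k (dk t)) ->
    exists2 c, 0 <= c <= s & k s - k 0 = s * dk c.
  move=> kdk.
  have dk' t : t \in `]0, s[ -> is_derive t (1 : R) k (dk t).
    by rewrite in_itv/= => /andP[t0 ts]; apply: kdk; rewrite !ltW.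
  have ck : {within `[0, s], continuous k}.
    apply: derivable_within_continuous => t; rewrite in_itv/= => /kdk.
    by case.
  have [c cs ->] := MVT s0 dk' ck; exists c; last by rewrite subr0 mulrC.
  by move: cs; rewrite in_itv/= => /andP[c0 cs]; rewrite !ltW.
have [c cs gE] := mvt0 _ _ dg.
pose k t := partial i h (y + c *: ei + t *: ej).
have dk (t : R) : 0 <= t <= s -> is_derive t (1 : R) k
    (partial j (partial i h) (y + c *: ei + t *: ej)).
  by move=> ts; apply: is_derive_along; apply: dih; exact: in_r.
have [d ds kE] := mvt0 _ _ dk.
exists (y + c *: ei + d *: ej); first exact: near_y.
rewrite expr2 -mulrA -kE /k scale0r addr0.
move: gE; rewrite /g !scale0r !addr0.
rewrite (addrAC y (s *: ej)) (addrAC y (s *: ej)) => <-.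
by ring.
Qed.

(** Both mixed derivatives are limits of the same second difference quotient. *)
Lemma partialC n (U : set 'rV[R]_n) (h : 'rV[R]_n -> R) (i j : 'I_n) y :
  open U -> smooth_on U h -> U y ->
  partial i (partial j h) y = partial j (partial i h) y.
Proof.
move=> oU sh Uy.
have /nbhs_ballP[r /= r0 rU] : nbhs y U by exact: open_nbhs_nbhs.
have inU z : `|z - y| < r -> U z.
  by move=> zr; apply: rU; rewrite -ball_normE /ball_/= distrC.
have dh z : `|z - y| < r -> differentiable h z.
  by move=> /inU; exact: (sh [::]).
have dih k z : `|z - y| < r -> differentiable (partial k h) z.
  by move=> /inU; exact: (sh [:: k]).
have cont k l : {for y, continuous (partial k (partial l h))}.
  by apply: differentiable_continuous; exact: (sh [:: k; l]).
apply/eqP; rewrite -subr_eq0 -normr_le0; apply/ler_addgt0Pl => e e0.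
rewrite addr0.
have close (a b a' b' : R) :
    a' = b' -> `|a - a'| < e / 2 -> `|b - b'| < e / 2 -> `|a - b| <= e.
  move=> -> ha hb; have -> : a - b = (a - b') - (b - b') by ring.
  rewrite (le_trans (ler_normB _ _))// ltW// [ltRHS]splitr; exact: ltrD.
have e2 : 0 < e / 2 by rewrite divr_gt0.
have /cvgrPdist_lt/(_ _ e2)/nbhs_ballP[r1 /= r10 H1] := cont i j.
have /cvgrPdist_lt/(_ _ e2)/nbhs_ballP[r2 /= r20 H2] := cont j i.
pose m := Num.min r (Num.min r1 r2).
have m0 : 0 < m by rewrite /m !lt_min r0 r10 r20.
have s0 : 0 < m / 4 by rewrite divr_gt0.
have sm : m / 4 + m / 4 < m by rewrite -mulrDl; lra.
have [sr sr1 sr2] : [/\ m / 4 + m / 4 < r, m / 4 + m / 4 < r1 & m / 4 + m / 4 < r2].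
  by split; apply: (lt_le_trans sm); rewrite /m !ge_min lexx ?orbT.
have [z zs zE] := @second_difference_mvt n h y r (m / 4) j i dh (dih j) s0 sr.
have [w ws wE] := @second_difference_mvt n h y r (m / 4) i j dh (dih i) s0 sr.
have zw : partial i (partial j h) z = partial j (partial i h) w.
  have sn0 : (m / 4) ^+ 2 != 0 by rewrite expf_neq0 ?gt_eqF.
  apply: (mulfI sn0); rewrite -zE -wE (addrAC y).
  by ring.
have {}H1 := H1 z; have {}H2 := H2 w.
have {}H1 : `|partial i (partial j h) y - partial i (partial j h) z| < e / 2.
  by apply: H1; rewrite -ball_normE /ball_/= distrC (le_lt_trans zs).
have {}H2 : `|partial j (partial i h) y - partial j (partial i h) w| < e / 2.
  by apply: H2; rewrite -ball_normE /ball_/= distrC (le_lt_trans ws).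
exact: (close _ _ _ _ zw H1 H2).
Qed.

End differential_calculus.

(** * Derivatives of matrix-valued curves *)

Section matrix_calculus.
Variable R : realType.

Lemma is_derive_mxP m n (A : R -> 'M[R]_(m, n)) (t : R) (A' : 'M[R]_(m, n)) :
  is_derive t (1 : R) A A' <->
  forall i j, is_derive t (1 : R) (fun s => A s i j) (A' i j).
Proof.
split=> [[dA <-] i j|dA].
  apply: DeriveDef; first exact: (derivable_mxP _ _ _).1.
  by rewrite derive_mx// mxE.
have dA' : derivable A t 1 by apply/derivable_mxP => i j; have [] := dA i j.
apply: DeriveDef => //; rewrite derive_mx//; apply/matrixP => i j.
by rewrite mxE; have [_ ->] := dA i j.
Qed.

Lemma is_derive_bigsum (I : Type) (r : seq I) (f : I -> R -> R) (f' : I -> R)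
    (t : R) : (forall i, is_derive t (1 : R) (f i) (f' i)) ->
  is_derive t (1 : R) (fun s => \sum_(i <- r) f i s) (\sum_(i <- r) f' i).
Proof.
move=> df; elim: r => [|i r IH].
  rewrite big_nil (_ : (fun _ => _) = cst 0); first exact: is_derive_cst.
  by apply/funext => s; rewrite big_nil.
rewrite big_cons (_ : (fun _ => _) = f i + (fun s => \sum_(i <- r) f i s)).
  exact: is_deriveD.
by apply/funext => s; rewrite big_cons.
Qed.

Lemma is_derive_mulmx m n p (A : R -> 'M[R]_(m, n)) (B : R -> 'M[R]_(n, p))
    (t : R) A' B' :
  is_derive t (1 : R) A A' -> is_derive t (1 : R) B B' ->
  is_derive t (1 : R) (fun s => A s *m B s) (A' *m B t + A t *m B').
Proof.
move=> /is_derive_mxP dA /is_derive_mxP dB; apply/is_derive_mxP => i j.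
rewrite !mxE -big_split /= (_ : (fun _ => _) = fun s => \sum_k A s i k * B s k j).
  apply: is_derive_bigsum => k.
  apply: (is_derive_eq (is_deriveM (dA i k) (dB k j))).
  by rewrite /GRing.scale /= addrC (mulrC (B t k j)).
by apply/funext => s; rewrite !mxE.
Qed.

Lemma is_derive_trmx m n (A : R -> 'M[R]_(m, n)) (t : R) A' :
  is_derive t (1 : R) A A' -> is_derive t (1 : R) (fun s => (A s)^T) A'^T.
Proof.
move=> /is_derive_mxP dA; apply/is_derive_mxP => i j; rewrite mxE.
by under eq_fun do rewrite mxE.
Qed.

Lemma derivable_det n (A : R -> 'M[R]_n) (t : R) :
  derivable A t 1 -> derivable (fun s => \det (A s)) t 1.
Proof.
move=> /derivable_mxP dA; rewrite /determinant.
suff dt (s : 'S_n) : derivable (fun u => (-1) ^+ s * \prod_i A u i (s i)) t 1.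
  by have [] := is_derive_bigsum (index_enum 'S_n) (fun s => derivableP (dt s)).
apply: derivableM; first exact: derivable_cst.
elim: (index_enum _) => [|i r IH].
  rewrite (_ : (fun _ => _) = cst 1); first exact: derivable_cst.
  by apply/funext => u; rewrite big_nil.
rewrite (_ : (fun _ => _) =
   (fun u => A u i (s i)) * (fun u => \prod_(j <- r) A u j (s j))).
  exact: derivableM.
by apply/funext => u; rewrite big_cons.
Qed.

Lemma derivable_continuous (V : normedModType R) (f : R -> V) (t : R) :
  derivable f t 1 -> {for t, continuous f}.
Proof. by move=> /derivable1_diffP; exact: differentiable_continuous. Qed.

Lemma near_unitmx n (A : R -> 'M[R]_n) (t : R) :
  derivable A t 1 -> A t \in unitmx -> \forall s \near t, A s \in unitmx.
Proof.
move=> dA; rewrite unitmxE unitfE => detA.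
have /derivable_continuous cdet := derivable_det dA.
have on0 : open_nbhs (\det (A t)) [set x : R | x != 0].
  by split => //; exact: open_neq.
have : \forall s \near t, \det (A s) != 0 by exact: cdet (open_nbhs_nbhs on0).
by apply: filterS => s /=; rewrite unitmxE unitfE.
Qed.

Lemma derivable_invmx n (A : R -> 'M[R]_n) (t : R) :
  derivable A t 1 -> A t \in unitmx -> derivable (fun s => invmx (A s)) t 1.
Proof.
move=> dA uA.
apply: (@near_eq_derivable _ _ _ (fun s => (\det (A s))^-1 *: \adj (A s))).
  have := near_unitmx dA uA; apply: filterS => s uAs.
  by rewrite /invmx uAs.
apply/derivable_mxP => i j.
rewrite (_ : (fun _ => _) = (fun s => (\det (A s))^-1) *
   (fun s => (-1) ^+ (j + i) * \det (row' j (col' i (A s))))); last first.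
  by apply/funext => s; rewrite !mxE.
apply: derivableM.
  apply: derivableV; last exact: derivable_det.
  by move: uA; rewrite unitmxE unitfE.
apply: derivableM; first exact: derivable_cst.
apply: derivable_det; apply/derivable_mxP => k l.
move/derivable_mxP : dA => /(_ (lift j k) (lift i l)).
by under [in X in _ -> X]eq_fun do rewrite !mxE.
Qed.

(** The entries of the inverse are derivable by the cofactor formula; once this
    is known, the value comes from differentiating [A * A^-1 = 1]. *)
Lemma is_derive_invmx n (A : R -> 'M[R]_n) (t : R) A' :
  is_derive t (1 : R) A A' -> A t \in unitmx ->
  is_derive t (1 : R) (fun s => invmx (A s)) (- (invmx (A t) *m A' *m invmx (A t))).
Proof.
move=> dA uA; have /derivableP di : derivable (fun s => invmx (A s)) t 1.
  by apply: derivable_invmx.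
apply: (is_derive_eq di); set B' := (X in X = _).
have : is_derive t (1 : R) (fun s => A s *m invmx (A s)) 0.
  have dc : is_derive t (1 : R) (cst 1%:M : R -> 'M[R]_n) 0.
    exact: is_derive_cst.
  apply: near_eq_is_derive dc.
  have := near_unitmx (@ex_derive _ _ _ _ _ _ _ dA) uA.
  by apply: filterS => s uAs; rewrite mulmxV.
move=> /@derive_val; have /@derive_val -> := is_derive_mulmx dA di.
rewrite -/B' => /eqP; rewrite addrC addr_eq0 => /eqP AB.
by rewrite -[B'](mulKmx uA) AB mulmxN mulmxA.
Qed.

(** The derivative of phi G^-1 phi^T, computed with
    [(G^-1)' = - G^-1 G' G^-1] and expressed through the vector v dual to phi. *)
Lemma is_derive_inv_energy n (G : R -> 'M[R]_n) (phi : R -> 'rV[R]_n) (t : R)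
    G' phi' (v := phi t *m invmx (G t)) :
  is_derive t (1 : R) G G' -> is_derive t (1 : R) phi phi' ->
  G t \in unitmx -> (G t)^T = G t ->
  is_derive t (1 : R) (fun s => pairing (invmx (G s)) (phi s) (phi s))
    (2 * (phi' *m v^T) 0 0 - pairing G' v v).
Proof.
move=> dG dphi uG symG.
have d1 := is_derive_mulmx dphi (is_derive_invmx dG uG).
have d2 := is_derive_mulmx d1 (is_derive_trmx dphi).
move/is_derive_mxP : d2 => /(_ 0 0) d2.
apply: (is_derive_eq d2); rewrite mxE mulmxDl mxE -/v.
have vT : v^T = invmx (G t) *m (phi t)^T by rewrite trmx_mul trmx_inv symG.
have -> : (phi' *m invmx (G t) *m (phi t)^T) 0 0 = (phi' *m v^T) 0 0.
  by rewrite vT mulmxA.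
have -> : (v *m phi'^T) 0 0 = (phi' *m v^T) 0 0.
  exact: mulmx_rowC.
have -> : (phi t *m - (invmx (G t) *m G' *m invmx (G t)) *m (phi t)^T) 0 0 =
    - pairing G' v v.
  by rewrite /pairing vT /v mulmxN mulNmx mxE !mulmxA.
by ring.
Qed.

End matrix_calculus.

(** * The gradient energy in a chart *)

Section chart_geometry.
Variables (R : realType) (n : nat) (M : manifold R n) (g : metric M).
Variable c : atlas M.
Implicit Types (y v w : 'rV[R]_n) (f : M -> R).

Definition differential_row (f : M -> R) y : 'rV[R]_n := \row_i partial i (f \o param c) y.

Definition energy f y : R := norm2 g c y (gradient g c f y).

Lemma gmat_posdef y : img c y -> posdef (gmat g c y).
Proof. by move=> cy v v0; exact: gmat_pos. Qed.

Lemma gmat_unit y : img c y -> gmat g c y \in unitmx.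
Proof. by move=> cy; exact/posdef_unitmx/gmat_posdef. Qed.

Lemma energyE f y : img c y ->
  energy f y = pairing (invmx (gmat g c y)) (differential_row f y) (differential_row f y).
Proof.
move=> cy; rewrite /energy /norm2 /pairing /gradient -/(differential_row f y).
rewrite trmx_mul trmx_inv gmat_sym// !mulmxA -(mulmxA (differential_row f y)).
by rewrite mulVmx ?gmat_unit// mulmx1.
Qed.

Lemma energy_ge0 f y : img c y -> 0 <= energy f y.
Proof.
move=> cy; rewrite /energy; have [->|v0] := eqVneq (gradient g c f y) 0.
  by rewrite /norm2 !mul0mx mxE.
by rewrite ltW// gmat_pos.
Qed.

Lemma gmat_partialC l i j y : img c y ->
  partial l (fun z => gmat g c z i j) y = partial l (fun z => gmat g c z j i) y.
Proof.
move=> cy; apply: near_eq_derive.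
have : nbhs y (img c) by apply: open_nbhs_nbhs; split => //; exact: open_img.
by apply: filterS => z cz; rewrite -{1}gmat_sym// mxE.
Qed.

Lemma christoffelC k i j y : img c y ->
  christoffel g c k i j y = christoffel g c k j i y.
Proof.
move=> cy; rewrite /christoffel; congr (_ * _); apply: eq_bigr => l _.
by congr (_ * _); rewrite (gmat_partialC l i j cy); congr (_ - _); rewrite addrC.
Qed.

Lemma hessian_sym f y : smooth_fun f -> img c y ->
  (hessian g c f y)^T = hessian g c f y.
Proof.
move=> sf cy; apply/matrixP => i j; rewrite mxE [LHS]mxE [RHS]mxE.
rewrite (partialC j i (open_img (c := c)) (sf c) cy).
by under eq_bigr => k _ do rewrite christoffelC//.
Qed.

(** The Hessian contracted with w and the gradient v. In the Christoffel term
    [v_k v_l (d_i g_kl + d_k g_il - d_l g_ik)], the last two summands cancel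
    because [v_k v_l] is symmetric; what remains is minus the derivative of the
    metric along w, evaluated on v. *)
Lemma hessian_pairingE f y w (v := gradient g c f y) : img c y ->
  2 * pairing (hessian g c f y) w v =
  2 * ((\row_k \sum_i w 0 i * partial i (partial k (f \o param c)) y) *m v^T) 0 0
  - pairing (\matrix_(a, b) \sum_i w 0 i * partial i (fun z => gmat g c z a b) y)
      v v.
Proof.
move=> cy.
pose d a k l := partial a (fun z => gmat g c z k l) y.
have vE l : v 0 l = \sum_m partial m (f \o param c) y * invmx (gmat g c y) m l.
  by rewrite /v /gradient mxE; apply: eq_bigr => m _; rewrite mxE.
(* lowering the upper index of the Christoffel symbols with the covector df *)
have GE i k : \sum_m christoffel g c m i k y * partial m (f \o param c) y =
    2^-1 * \sum_l v 0 l * (d i k l + d k i l - d l i k).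
  rewrite mulr_sumr; under eq_bigr do rewrite /christoffel -mulrA mulr_suml mulr_sumr.
  rewrite exchange_big /=; apply: eq_bigr => l _.
  rewrite vE -mulr_sumr; congr (_ * _); rewrite mulr_suml; apply: eq_bigr => m _.
  by rewrite -/(d i k l) -/(d k i l) -/(d l i k) mulrAC; congr (_ * _); rewrite mulrC.
clearbody v.
have -> : pairing (hessian g c f y) w v =
    ((\row_k \sum_i w 0 i * partial i (partial k (f \o param c)) y) *m v^T) 0 0
    - 2^-1 * \sum_i \sum_k \sum_l w 0 i * (d i k l + d k i l - d l i k) * v 0 k * v 0 l.
  rewrite pairingE mxE.
  under [X in _ = X - _]eq_bigr do rewrite !mxE mulr_suml.
  rewrite [X in _ = X - _]exchange_big /= mulr_sumr -sumrB; apply: eq_bigr => i _.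
  rewrite mulr_sumr -sumrB; apply: eq_bigr => k _.
  rewrite mxE GE mulrBr mulrBl; congr (_ - _).
  rewrite mulrCA -mulrA; congr (_ * _); rewrite mulr_sumr mulr_suml.
  apply: eq_bigr => l _; set dd := d i k l + _ - _.
  by ring.
rewrite mulrBr; congr (_ - _); rewrite mulrA divff ?pnatr_eq0// mul1r.
have -> : pairing (\matrix_(a, b) \sum_i w 0 i * partial i (fun z => gmat g c z a b) y)
      v v = \sum_i \sum_k \sum_l w 0 i * d i k l * v 0 k * v 0 l.
  rewrite pairingE exchange_big [RHS]exchange_big /=.
  under [RHS]eq_bigr do rewrite exchange_big /=.
  rewrite exchange_big /=; apply: eq_bigr => k _; apply: eq_bigr => l _.
  rewrite mxE mulr_sumr mulr_suml; apply: eq_bigr => i _; rewrite -/(d i k l).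
  by rewrite mulrC; set dd := d i k l; ring.
apply: eq_bigr => i _.
have -> : \sum_k \sum_l w 0 i * (d i k l + d k i l - d l i k) * v 0 k * v 0 l =
  \sum_k \sum_l w 0 i * d i k l * v 0 k * v 0 l +
  (\sum_k \sum_l w 0 i * d k i l * v 0 k * v 0 l -
   \sum_k \sum_l w 0 i * d l i k * v 0 k * v 0 l).
  rewrite -sumrB -big_split /=; apply: eq_bigr => k _.
  rewrite -sumrB -big_split /=; apply: eq_bigr => l _.
  move: (d i k l) (d k i l) (d l i k) (v 0 k) (v 0 l) (w 0 i) => *; ring.
(* the two remaining sums are exchanged by swapping k and l *)
rewrite [X in _ + (_ - X)]exchange_big /=.
rewrite [X in _ + X](_ : _ = 0) ?addr0//; apply/eqP; rewrite subr_eq0; apply/eqP.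
by apply: eq_bigr => k _; apply: eq_bigr => l _; rewrite mulrAC.
Qed.

(** [d |grad f|^2 = 2 Hess f (grad f, .)]: the Levi-Civita connection is metric. *)
Lemma is_derive_energy f (y : R -> 'rV[R]_n) (t : R) w :
  smooth_fun f -> img c (y t) -> is_derive t (1 : R) y w ->
  is_derive t (1 : R) (energy f \o y)
    (2 * pairing (hessian g c f (y t)) w (gradient g c f (y t))).
Proof.
move=> sf cy dy.
have cont_y : {for t, continuous y}.
  by apply: derivable_continuous; have [] := dy.
have near_img : \forall s \near t, img c (y s).
  by apply: cont_y; apply: open_nbhs_nbhs; split => //; exact: open_img.
rewrite hessian_pairingE//.
apply: (@near_eq_is_derive _ _ _ (fun s => pairing (invmx (gmat g c (y s)))
    (differential_row f (y s)) (differential_row f (y s)))).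
  by apply: filterS near_img => s cys /=; rewrite energyE.
apply: is_derive_inv_energy; last 2 first.
- exact: gmat_unit.
- exact: gmat_sym.
- apply/is_derive_mxP => a b; rewrite mxE.
  have dg : differentiable (fun z => gmat g c z a b) (y t).
    exact: (@gmat_smooth _ _ _ g c a b [::]).
  by apply: (is_derive_eq (is_derive_comp_curve dg dy)); rewrite derive_partialE.
- apply/is_derive_mxP => a k; rewrite mxE.
  have dF : differentiable (partial k (f \o param c)) (y t).
    exact: (sf c [:: k]).
  under eq_fun do rewrite mxE.
  by apply: (is_derive_eq (is_derive_comp_curve dF dy)); rewrite derive_partialE.
Qed.

End chart_geometry.

(** * The differential inequality for the scalar curvature *)

Section soliton_in_chart.
Variables (R : realType) (n : nat) (M : manifold R n) (g : metric M) (f : M -> R).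
Hypothesis steady : steady_soliton g f.
Hypothesis norm1 : normalized g f.
Hypothesis nonneg : ricci_nonneg g.
Variable c : atlas M.
Implicit Types (y v w : 'rV[R]_n).

Lemma ricci_hessianE y : img c y -> ricci g c y = - hessian g c f y.
Proof.
move=> cy; apply/eqP; rewrite -addr_eq0.
by have [_ ->//] := steady; rewrite scale0r.
Qed.

(** The Ricci tensor is minus a Hessian, so its symmetry is that of second
    derivatives. *)
Lemma ricci_sym y : img c y -> (ricci g c y)^T = ricci g c y.
Proof.
move=> cy; rewrite ricci_hessianE// linearN /= hessian_sym//.
by have [] := steady.
Qed.

Lemma scal_in_energyE y : img c y -> scal_in g c y = 1 - energy g c f y.
Proof. by move=> cy; rewrite -(norm1 cy) addrK. Qed.

Lemma scal_in_ge0 y : img c y -> 0 <= scal_in g c y.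
Proof.
move=> cy; apply: psd_trace_inv_ge0; first exact: gmat_sym.
  exact: gmat_posdef.
by move=> v; exact: nonneg.
Qed.

Lemma scal_in_le1 y : img c y -> scal_in g c y <= 1.
Proof. by move=> cy; rewrite scal_in_energyE// lerBlDr lerDl energy_ge0. Qed.

Lemma ricci_pairing_le y w v : img c y ->
  `|pairing (ricci g c y) w v| <=
    Num.sqrt (norm2 g c y w) * Num.sqrt (norm2 g c y v) * scal_in g c y.
Proof.
move=> cy; apply: psd_pairing_le; first exact: gmat_sym.
- exact: gmat_posdef.
- exact: ricci_sym.
- by move=> u; exact: nonneg.
Qed.

Lemma ricci_eq0 y : img c y -> scal_in g c y = 0 -> ricci g c y = 0.
Proof.
move=> cy s0; apply/matrixP => i j; rewrite [RHS]mxE -pairing_delta.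
apply/eqP; rewrite -normr_le0.
by rewrite (le_trans (ricci_pairing_le _ _ cy))// s0 mulr0.
Qed.

(** Since [scal = 1 - |grad f|^2] and [Hess f = - Rc], the derivative of the
    scalar curvature in the direction w is [2 Rc (w, grad f)]. As Rc is
    nonnegative it is bounded by its trace, and [|grad f| <= 1]. *)
Lemma scal_in_derive (y : R -> 'rV[R]_n) (t : R) w :
  img c (y t) -> is_derive t (1 : R) y w ->
  exists2 d : R, is_derive t (1 : R) (scal_in g c \o y) d &
    `|d| <= 2 * Num.sqrt (norm2 g c (y t) w) * scal_in g c (y t).
Proof.
move=> cy dy; have [sf _] := steady.
have cont_y : {for t, continuous y}.
  by apply: derivable_continuous; have [] := dy.
have near_img : \forall s \near t, img c (y s).
  by apply: cont_y; apply: open_nbhs_nbhs; split => //; exact: open_img.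
set v := gradient g c f (y t).
exists (2 * pairing (ricci g c (y t)) w v).
  apply: (@near_eq_is_derive _ _ _ (cst 1 - (energy g c f \o y))).
    by apply: filterS near_img => s cys /=; rewrite scal_in_energyE.
  have dc : is_derive t (1 : R) (cst 1 : R -> R) 0 by exact: is_derive_cst.
  have := is_deriveB dc (is_derive_energy g sf cy dy).
  rewrite (_ : 0 - _ = 2 * pairing (ricci g c (y t)) w v)//.
  have -> : pairing (ricci g c (y t)) w v = - pairing (hessian g c f (y t)) w v.
    by rewrite ricci_hessianE// /pairing mulmxN mulNmx mxE.
  by rewrite sub0r mulrN.
rewrite normrM ger0_norm// -mulrA ler_wpM2l//.
apply: (le_trans (ricci_pairing_le _ _ cy)).
rewrite ler_wpM2r ?scal_in_ge0// ler_piMr ?sqrtr_ge0//.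
rewrite -sqrtr1 ler_wsqrtr//.
have := norm1 cy; rewrite -/v => <-.
by rewrite lerDr scal_in_ge0.
Qed.

End soliton_in_chart.

(** * Independence of the chart *)

Section change_of_chart.
Variables (R : realType) (n : nat) (M : manifold R n) (g : metric M).
Variables a b : atlas M.

Lemma transition_domain_open :
  open [set y | img a y /\ dom b (param a y)].
Proof.
rewrite openE => y [ay bay]; rewrite /interior /=.
have na : nbhs y (img a) by apply: open_nbhs_nbhs; split => //; exact: open_img.
have nb : nbhs (param a y) (dom b).
  by apply: open_nbhs_nbhs; split => //; exact: open_dom.
exact: filterI na (param_continuous ay nb).
Qed.

Lemma transition_differentiable x : dom a x -> dom b x ->
  differentiable (chart b \o param a) (chart a x).
Proof.
move=> ax bx; apply: (@transition_smooth _ _ M a b [::]).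
by split; [exact: chart_img|rewrite chartK].
Qed.

Lemma near_transition_domain x : dom a x -> dom b x ->
  \forall y \near chart a x, img a y /\ dom b (param a y).
Proof.
move=> ax bx; apply: (open_nbhs_nbhs (conj transition_domain_open _)).
by split; [exact: chart_img|rewrite chartK].
Qed.

(** Covectors change by the transpose of the Jacobian J when vectors are
    row vectors multiplied by J on the right. *)
Lemma differential_row_change (f : M -> R) x : smooth_fun f -> dom a x -> dom b x ->
  differential_row a f (chart a x) =
  differential_row b f (chart b x) *m ('J (chart b \o param a) (chart a x))^T.
Proof.
move=> sf ax bx; set T := chart b \o param a; set y := chart a x.
have Ty : T y = chart b x by rewrite /T /y /= chartK.
have dT : differentiable T y by exact: transition_differentiable.
have dF : differentiable (f \o param b) (T y).
  by apply: (sf b [::]); rewrite Ty; exact: chart_img.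
apply/rowP => i; rewrite !mxE.
have -> : partial i (f \o param a) y = partial i ((f \o param b) \o T) y.
  apply: near_eq_derive; have := near_transition_domain ax bx.
  by apply: filterS => z [az bz] /=; rewrite /T /= chartK.
rewrite /partial deriveE; last exact: differentiable_comp.
rewrite diff_comp//= -deriveE// -[X in 'D_X _ _](mul_rV_lin1 _ _).
rewrite derive_partialE//; apply: eq_bigr => k _.
by rewrite -/(jacobian _ _) -rowE Ty !mxE mulrC.
Qed.

Lemma energy_change (f : M -> R) x : smooth_fun f -> dom a x -> dom b x ->
  energy g a f (chart a x) = energy g b f (chart b x).
Proof.
move=> sf ax bx; have ay := chart_img ax; have by_ := chart_img bx.
rewrite !energyE// (differential_row_change sf ax bx).
have := gmat_change g ax bx; set J := jacobian _ _ => GJ.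
have := gmat_unit g ay; rewrite GJ !unitmx_mul unitmx_tr => /andP[/andP[uJ _] uJT].
have uJT' : J^T \in unitmx by rewrite unitmx_tr.
have uG := gmat_unit g by_.
rewrite -pairing_congr trmxK !invmx_mul ?unitmx_mul ?uJ//.
by rewrite !mulmxA mulmxV// mul1mx -mulmxA mulVmx// mulmx1.
Qed.

(** Near t, [chart b \o gamma] is the transition map after [chart a \o gamma], so
    velocities change by the Jacobian, as the matrices of the metric do. *)
Lemma velocity_change (gamma : R -> M) (t : R) :
  (\forall s \near t, dom a (gamma s)) -> dom b (gamma t) ->
  derivable (chart a \o gamma) t 1 ->
  derivable (chart b \o gamma) t 1 /\
  norm2 g b (chart b (gamma t)) (derive1 (chart b \o gamma) t) =
  norm2 g a (chart a (gamma t)) (derive1 (chart a \o gamma) t).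
Proof.
move=> near_a bt da; have at_ : dom a (gamma t) by exact: nbhs_singleton near_a.
set T := chart b \o param a.
have dT : differentiable T (chart a (gamma t)) by exact: transition_differentiable.
have db : is_derive t (1 : R) (chart b \o gamma)
    ('D_('D_1 (chart a \o gamma) t) T (chart a (gamma t))).
  apply: near_eq_is_derive (is_derive_comp_curve (y := chart a \o gamma) dT (derivableP da)).
  by apply: filterS near_a => s as_; rewrite /T /= chartK.
split; first by have [] := db.
rewrite !derive1E; have [_ ->] := db.
rewrite deriveEjacobian// /norm2 (gmat_change g at_ bt) /=.
by rewrite trmx_mul !mulmxA.
Qed.

End change_of_chart.

(** * A Gronwall inequality *)

Section gronwall.
Variable R : realType.

(** The function [h t * expR (K * int_0^t s)] is nondecreasing on [[0, 1]]. *)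
Lemma gronwall_lower (K : R) (h s d : R -> R) :
  (forall t : R, 0 <= t <= 1 -> {for t, continuous s}) ->
  (forall t : R, 0 <= t <= 1 -> is_derive t (1 : R) h (d t)) ->
  (forall t : R, 0 <= t <= 1 -> - (K * s t * h t) <= d t) ->
  h 0 <= h 1 * expR (K * \int[lebesgue_measure]_(t in `[0, 1]) s t).
Proof.
move=> cs dh hd.
have ints : lebesgue_measure.-integrable `[0, 1] (EFin \o s).
  apply: continuous_compact_integrable; first exact: segment_compact.
  by apply: continuous_in_subspaceT => t /set_mem; rewrite /= in_itv/=; exact: cs.
pose F t := \int[lebesgue_measure]_(u in `[0, t]) s u.
have dF (t : R) : t \in `]0, 1[ -> is_derive t (1 : R) F (s t).
  rewrite in_itv/= => /andP[t0 t1].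
  have ct : {for t, continuous s} by apply: cs; rewrite !ltW.
  have [dFt FE] := continuous_FTC1_closed t1 ints t0 ct.
  by apply: DeriveDef; [exact: dFt|rewrite -derive1E; exact: FE].
have cF : {within `[0, 1], continuous F}.
  exact: parameterized_integral_continuous.
pose E t := h t * expR (K * F t).
have dE (t : R) : t \in `]0, 1[ ->
    is_derive t (1 : R) E (expR (K * F t) * (d t + K * s t * h t)).
  move=> t01; have dFt := dF t t01.
  have dht : is_derive t (1 : R) h (d t).
    by apply: dh; move: t01; rewrite in_itv/= => /andP[t0 t1]; rewrite !ltW.
  have d2F : is_derive t (1 : R) (fun u => K * F u) (K * s t).
    exact: (is_deriveZ K dFt).
  have de : is_derive t (1 : R) (fun u => expR (K * F u)) (expR (K * F t) * (K * s t)).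
    have dexp := is_derive_expR (K * F t).
    have := @is_derive1_comp R expR (fun u => K * F u) t _ _ dexp d2F.
    by rewrite /GRing.scale /= mulrC.
  have := is_deriveM dht de; rewrite (_ : _ + _ = expR (K * F t) * (d t + K * s t * h t))//.
  by rewrite /GRing.scale /=; ring.
have ch : {within `[0, 1], continuous h}.
  apply: continuous_in_subspaceT => t /set_mem; rewrite /= in_itv/= => t01.
  by apply: derivable_continuous; have [] := dh t t01.
have cexp : continuous (fun u : R => expR (K * u)).
  move=> u; apply: (@continuous_comp R R R (fun u => K * u) expR).
    exact: mulrl_continuous.
  exact: continuous_expR.
have ce : {within `[0, 1], continuous (fun t => expR (K * F t))}.
  by move=> x; exact: (continuous_comp (cF x) (cexp (F x))).
have cE : {within `[0, 1], continuous E}.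
  by move=> x; exact: (continuousM (ch x) (ce x)).
have mono := ger0_derive1_le_cc _ _ cE.
have : E 0 <= E 1.
  apply: mono; rewrite ?in_itv/= ?lexx ?ler01// => t t01.
    by have [] := dE t t01.
  rewrite derive1E; have [_ ->] := dE t t01.
  rewrite mulr_ge0 ?expR_ge0// -lerBlDr sub0r; apply: hd.
  by move: t01; rewrite in_itv/= => /andP[t0 t1]; rewrite !ltW.
by rewrite /E /F set_itv1 Rintegral_set1 mulr0 expR0 mulr1.
Qed.

End gronwall.

(** * Scalar curvature along curves *)

Section curves_in_charts.
Variables (R : realType) (n : nat) (M : manifold R n) (g : metric M).

Lemma continuous_pairing (A : R -> 'M[R]_n) (u : R -> 'rV[R]_n) (t : R) :
  (forall i j, {for t, continuous (fun s => A s i j)}) ->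
  {for t, continuous u} ->
  {for t, continuous (fun s => pairing (A s) (u s) (u s))}.
Proof.
move=> cA cu; have cui i : {for t, continuous (fun s => u s 0 i)}.
  apply: (@continuous_comp _ _ _ u (fun v : 'rV[R]_n => v 0 i)) => //.
  exact: coord_continuous.
suff : pairing (A s) (u s) (u s) @[s --> t] --> pairing (A t) (u t) (u t) by [].
under eq_cvg do rewrite pairingE.
rewrite pairingE.
apply: cvg_big => [|i _]; first exact: add_continuous.
apply: cvg_big => [|j _]; first exact: add_continuous.
by apply: cvgM; [apply: cvgM; [exact: cui|exact: cA]|exact: cui].
Qed.

Lemma near_eq_continuous (V : normedModType R) (u v : R -> V) (t : R) :
  (\forall s \near t, u s = v s) -> {for t, continuous v} ->
  {for t, continuous u}.
Proof.
move=> uv cv; have : v s @[s --> t] --> v t by [].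
rewrite -(nbhs_singleton uv); apply: cvg_trans; apply: near_eq_cvg.
by apply: filterS uv => s.
Qed.

Lemma near_dom c (gamma : R -> M) (t : R) :
  {for t, continuous gamma} -> dom c (gamma t) -> \forall s \near t, dom c (gamma s).
Proof.
move=> cg ct; apply: cg; apply: open_nbhs_nbhs; split => //; exact: open_dom.
Qed.

(** The speed is defined with a chart that depends on the point and may jump
    along the curve; any fixed chart around the point gives the same value. *)
Lemma speed_chart c (gamma : R -> M) (t : R) :
  (\forall s \near t, dom c (gamma s)) -> derivable (chart c \o gamma) t 1 ->
  speed g gamma t =
  Num.sqrt (norm2 g c (chart c (gamma t)) (derive1 (chart c \o gamma) t)).
Proof.
move=> near_c dc; rewrite /speed /=.
by have [_ ->] := velocity_change g near_c (dom_chart_at (gamma t)) dc.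
Qed.

(** Continuity makes the speed integrable, and equal to the derivative of the
    arc length, as [gronwall_lower] requires. *)
Lemma speed_continuous (gamma : R -> M) (t : R) : C1_at gamma t ->
  {for t, continuous (speed g gamma)}.
Proof.
move=> [cg C1]; set c := chart_at (gamma t).
have ct : dom c (gamma t) by exact: dom_chart_at.
have [near_d cd] := C1 c ct; have near_c := near_dom cg ct.
have speedE : \forall s \near t, speed g gamma s =
    Num.sqrt (norm2 g c (chart c (gamma s)) (derive1 (chart c \o gamma) s)).
  by apply: filterS2 near_d (near_join near_c) => s ds cs; exact: speed_chart.
pose N s := norm2 g c (chart c (gamma s)) (derive1 (chart c \o gamma) s).
suff cN : {for t, continuous N}.
  apply: near_eq_continuous speedE _.
  exact: (continuous_comp cN (@sqrt_continuous R (N t))).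
apply: continuous_pairing => // i j.
apply: (@continuous_comp _ _ _ (chart c \o gamma) (fun z => gmat g c z i j)).
  by apply: derivable_continuous; exact: nbhs_singleton near_d.
apply: differentiable_continuous; apply: (@gmat_smooth _ _ _ g c i j [::]).
exact: chart_img.
Qed.

End curves_in_charts.

Section soliton_along_curves.
Variables (R : realType) (n : nat) (M : manifold R n) (g : metric M) (f : M -> R).
Hypothesis steady : steady_soliton g f.
Hypothesis norm1 : normalized g f.
Hypothesis nonneg : ricci_nonneg g.

(** Chart independence of the scalar curvature comes from that of
    [1 - |grad f|^2], which involves first derivatives only; this avoids
    transforming the curvature tensor. *)
Lemma scal_chart c x : dom c x -> scal g x = scal_in g c (chart c x).
Proof.
move=> cx; have [sf _] := steady; rewrite /scal.
rewrite !(scal_in_energyE norm1) ?(energy_change g sf (dom_chart_at x) cx)//.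
  exact: chart_img.
by apply: chart_img; exact: dom_chart_at.
Qed.

Lemma scal_ge0 x : 0 <= scal g x.
Proof. exact: (scal_in_ge0 nonneg (chart_img (dom_chart_at x))). Qed.

Lemma scal_le1 x : scal g x <= 1.
Proof. exact: (scal_in_le1 norm1 (chart_img (dom_chart_at x))). Qed.

Lemma scal_derive_along (gamma : R -> M) (t : R) : C1_at gamma t ->
  exists2 d : R, is_derive t (1 : R) (scal g \o gamma) d &
    `|d| <= 2 * speed g gamma t * scal g (gamma t).
Proof.
move=> [cg C1]; set c := chart_at (gamma t).
have ct : dom c (gamma t) by exact: dom_chart_at.
have [near_d _] := C1 c ct; have near_c := near_dom cg ct.
have /derivableP dc : derivable (chart c \o gamma) t 1 by exact: nbhs_singleton near_d.
have [d dd dle] := scal_in_derive steady norm1 nonneg (y := chart c \o gamma) (chart_img ct) dc.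
exists d.
  by apply: near_eq_is_derive dd; apply: filterS near_c => s cs /=; rewrite (scal_chart cs).
rewrite (scal_chart ct) (speed_chart g near_c); last exact: nbhs_singleton near_d.
by rewrite derive1E.
Qed.

Lemma scal_C1_curve (gamma : R -> M) :
  (forall t : R, 0 <= t <= 1 -> C1_at gamma t) ->
  scal g (gamma 0) <= scal g (gamma 1) * expR (2 * curve_length g gamma).
Proof.
move=> C1.
have /choice[d dP] : forall t : R, exists d : R, 0 <= t <= 1 ->
    is_derive t (1 : R) (scal g \o gamma) d /\
    `|d| <= 2 * speed g gamma t * scal g (gamma t).
  move=> t; have [t01|] := boolP (0 <= t <= 1); last by exists 0.
  by have [d d1 d2] := scal_derive_along (C1 t t01); exists d.
apply: (gronwall_lower (K := 2) (h := scal g \o gamma) (d := d)) => t t01.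
- exact/speed_continuous/C1.
- by have [] := dP t t01.
- by have [_] := dP t t01; rewrite ler_norml => /andP[].
Qed.

Lemma scal_piecewise_C1_curve x y p : piecewise_C1 x y p ->
  scal g x <= scal g y * expR (2 * \sum_(gamma <- p) curve_length g gamma).
Proof.
elim: p x => [|gamma q IH] x /=; first by move=> ->; rewrite big_nil mulr0 expR0 mulr1.
move=> [C1 <- /IH le_q]; rewrite big_cons mulrDr expRD.
rewrite [X in _ * X]mulrC mulrA; apply: (le_trans (scal_C1_curve C1)).
by rewrite ler_wpM2r ?expR_ge0.
Qed.

End soliton_along_curves.

(** * Joining points by piecewise smooth curves *)

Section piecewise_C1_connectivity.
Variables (R : realType) (n : nat) (M : manifold R n).

Lemma piecewise_C1_cat (x y z : M) p q :
  piecewise_C1 x y p -> piecewise_C1 y z q -> piecewise_C1 x z (p ++ q).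
Proof.
elim: p x => [|gamma p IH] x /=; first by move=> ->.
by move=> [C1 g0 xy] yz; split => //; exact: IH.
Qed.

Lemma continuous_lincomb (V : normedModType R) (a : 'I_n -> R)
    (h : 'I_n -> R -> V) (t : R) :
  (forall i, {for t, continuous (h i)}) ->
  {for t, continuous (fun s => \sum_i a i *: h i s)}.
Proof.
move=> ch; apply: cvg_big => [|i _]; first exact: add_continuous.
by apply: cvgZ; [exact: cvg_cst|exact: ch].
Qed.

(** In another chart b, the velocity of the segment is
    [sum_i v_i d_i T] along it, T being the transition map; it is continuous
    because T is smooth. *)
Lemma chart_segment_C1 (c : atlas M) (p v : 'rV[R]_n) (t : R) :
  img c (p + t *: v) -> C1_at (fun s : R => param c (p + s *: v)) t.
Proof.
move=> ct; set y := fun s : R => p + s *: v.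
have dy s : is_derive s (1 : R) y v by exact: is_derive_line.
have cy : {for t, continuous y}.
  by apply: derivable_continuous; have [] := dy t.
have cgamma : {for t, continuous (param c \o y)}.
  exact: (continuous_comp cy (param_continuous ct)).
split=> // b bt; set T := chart b \o param c.
pose W := [set z | img c z /\ dom b (param c z)].
have oW : open W by exact: transition_domain_open.
have near_W : \forall s \near t, W (y s).
  by apply: cy; apply: open_nbhs_nbhs; split.
have smT : smooth_on W T by exact: transition_smooth.
have dT s : W (y s) -> is_derive s (1 : R) (chart b \o (param c \o y))
    (\sum_i v 0 i *: partial i T (y s)).
  move=> Ws; have dTs : differentiable T (y s) by exact: (smT [::]).
  by rewrite -derive_partialE//; exact: (is_derive_comp_curve dTs (dy s)).
split; first by apply: filterS near_W => s /dT[].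
apply: (@near_eq_continuous _ _ _ (fun s => \sum_i v 0 i *: partial i T (y s))).
  by apply: filterS near_W => s /dT[_ <-]; rewrite derive1E.
apply: continuous_lincomb => i.
have cpT : {for y t, continuous (partial i T)}.
  apply: differentiable_continuous; apply: (smT [:: i]).
  exact: nbhs_singleton near_W.
exact: (continuous_comp cy cpT).
Qed.

Lemma ball_segment (z p q : 'rV[R]_n) (r t : R) :
  ball z r p -> ball z r q -> 0 <= t <= 1 -> ball z r (p + t *: (q - p)).
Proof.
rewrite -!ball_normE /ball_/= => zp zq /andP[t0 t1].
have -> : z - (p + t *: (q - p)) = (1 - t) *: (z - p) + t *: (z - q).
  by apply/rowP => i; rewrite !mxE; ring.
rewrite (le_lt_trans (ler_normD _ _))// !normrZ !ger0_norm ?subr_ge0//.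
have [->|tn1] := eqVneq t 1; first by rewrite subrr mul0r add0r mul1r.
have -> : r = (1 - t) * r + t * r by rewrite -mulrDl subrK mul1r.
apply: ltr_leD; last by rewrite ler_wpM2l// ltW.
by rewrite ltr_pM2l// subr_gt0 lt_neqAle tn1.
Qed.

Lemma locally_C1_connected (x : M) : exists U : set M,
  [/\ nbhs x U & forall y z, U y -> U z -> exists p, piecewise_C1 y z p].
Proof.
set c := chart_at x; have cx : dom c x by exact: dom_chart_at.
have : nbhs (chart c x) (img c).
  by apply: open_nbhs_nbhs; split; [exact: open_img|exact: chart_img].
move=> /nbhs_ballP[r /= r0 rc].
exists (dom c `&` (chart c @^-1` ball (chart c x) r)); split.
  apply: filterI; first by apply: open_nbhs_nbhs; split => //; exact: open_dom.
  exact: (chart_continuous cx (nbhsx_ballx _ _ r0)).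
move=> y z [cy ry] [cz rz].
exists [:: fun s : R => param c (chart c y + s *: (chart c z - chart c y))] => /=.
split.
- by move=> t t01; apply: chart_segment_C1; apply: rc; exact: ball_segment.
- by rewrite scale0r addr0 chartK.
- by rewrite scale1r addrC subrK chartK.
Qed.

(** The set of points that can be joined to x is open and closed: a point and
    all points of a coordinate ball around it can be joined by segments. *)
Lemma piecewise_C1_connected (x y : M) : connected [set: M] ->
  exists p, piecewise_C1 x y p.
Proof.
move=> connM; pose A := [set z | exists p, piecewise_C1 x z p].
suff : A = [set: M] by move=> AT; have : A y by rewrite AT.
apply: connM.
- by exists x; exists [::].
- exists A; last by rewrite setTI.
  rewrite openE => z [p xz]; have [U [Uz UP]] := locally_C1_connected z.
  apply: (filterS _ Uz) => w Uw.
  have [q zw] := UP z w (nbhs_singleton Uz) Uw.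
  by exists (p ++ q); exact: piecewise_C1_cat xz zw.
- exists A; last by rewrite setTI.
  move=> z Az; have [U [Uz UP]] := locally_C1_connected z.
  have [w [[p xw] Uw]] := Az U Uz.
  have [q wz] := UP w z Uw (nbhs_singleton Uz).
  by exists (p ++ q); exact: piecewise_C1_cat xw wz.
Qed.

End piecewise_C1_connectivity.

(** * Exponential decay and the theorem *)

(** [1 / cosh t <= 2 e^-t], because [2 cosh t >= e^t]. *)
Lemma sech_sqr_le (R : realType) (t : R) :
  sech t ^+ 2 <= 4 * expR (- (2 * t)).
Proof.
have cosh_gt0 : 0 < cosh t by rewrite divr_gt0// addr_gt0// expR_gt0.
have -> : 4 * expR (- (2 * t)) = (2 * expR (- t)) ^+ 2.
  by rewrite exprMn -expRM_natl mulrN; congr (_ * _); ring.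
rewrite ler_sqr ?nnegrE ?mulr_ge0 ?expR_ge0//; last by rewrite invr_ge0 ltW.
rewrite /sech -[leLHS]div1r ler_pdivrMr// /cosh.
have -> : 2 * expR (- t) * ((expR t + expR (- t)) / 2) =
    expR (- t) * expR t + expR (- t) ^+ 2 by field.
by rewrite -expRD addNr expR0 lerDl exprn_ge0// expR_ge0.
Qed.

Section scalar_curvature_decay.
Variables (R : realType) (n : nat) (M : manifold R n) (g : metric M) (f : M -> R).
Hypothesis connM : connected [set: M].
Hypothesis steady : steady_soliton g f.
Hypothesis norm1 : normalized g f.
Hypothesis nonneg : ricci_nonneg g.

(** If the scalar curvature vanished at x, the bound along curves ending at x
    would make it vanish everywhere; Rc being nonnegative with zero trace, the
    metric would be Ricci flat. *)
Lemma scal_gt0 x : ~ ricci_flat g -> 0 < scal g x.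
Proof.
move=> nflat; rewrite lt_def (scal_ge0 nonneg) andbT; apply/eqP => x0.
apply: nflat => c y cy; apply: (ricci_eq0 steady nonneg cy).
have <- : scal g (param c y) = scal_in g c y.
  by rewrite (scal_chart steady norm1 (param_dom cy)) paramK.
have [p px] := piecewise_C1_connected (param c y) x connM.
apply/eqP; rewrite eq_le (scal_ge0 nonneg) andbT.
by have := scal_piecewise_C1_curve steady norm1 nonneg px; rewrite x0 mul0r.
Qed.

(** In logarithmic form, the bound along curves says that
    [ln (scal x / scal y) / 2] is a lower bound of the lengths, hence of their
    infimum. That the set of lengths is nonempty matters, as the infimum of the
    empty set is 0. *)
Lemma scal_exp_decay x y : ~ ricci_flat g ->
  scal g x <= scal g y * expR (2 * rdist g x y).
Proof.
move=> nflat; have sx := scal_gt0 x nflat; have sy := scal_gt0 y nflat.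
rewrite [leRHS]mulrC -ler_pdivrMr// -[leLHS]lnK ?posrE ?divr_gt0// ler_expR.
rewrite [leRHS]mulrC -ler_pdivrMr//; apply: lb_le_inf.
  have [p xy] := piecewise_C1_connected x y connM.
  by eexists; exists p.
move=> _ [p xy <-]; rewrite ler_pdivrMr// -ler_expR lnK ?posrE ?divr_gt0//.
rewrite ler_pdivrMr// mulrC [X in expR X]mulrC.
exact: (scal_piecewise_C1_curve steady norm1 nonneg xy).
Qed.

End scalar_curvature_decay.

Theorem corollary2 (R : realType) (n : nat) (M : manifold R n)
    (connM : connected [set: M]) :
  exists k : M -> R -> R,
    forall (g : metric M) (f : M -> R),
      complete_metric g ->
      steady_soliton g f ->
      ~ ricci_flat g ->
      normalized g f ->
      ricci_nonneg g ->
      forall O : M,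
        0 < k O (scal g O) <= 1 /\
        forall x : M, k O (scal g O) * sech (rdist g O x) ^+ 2 <= scal g x.
Proof.
(* s e^(-2r) >= (s / 4) sech^2 r, by [sech_sqr_le] *)
exists (fun _ s => s / 4) => g f _ steady nflat norm1 nonneg O; split.
  rewrite divr_gt0 ?(scal_gt0 connM steady norm1 nonneg)//=.
  by rewrite ler_pdivrMr// mul1r (le_trans (scal_le1 norm1 O))// ler1n.
move=> x; set r := rdist g O x.
have := scal_exp_decay connM steady norm1 nonneg O x nflat; rewrite -/r => decay.
apply: (@le_trans _ _ (scal g O / 4 * (4 * expR (- (2 * r))))).
  by rewrite ler_wpM2l ?sech_sqr_le// divr_ge0// (scal_ge0 nonneg).
by rewrite mulrA divfK ?pnatr_eq0// expRN ler_pdivrMr ?expR_gt0.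
Qed.
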